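(* Let $d\ge 1$ and let $\Sigma_d$ be the set of all signatures of degree $d$. The incidence relation $\prec$ on $\Sigma_d$ (where $\sigma\prec\tau$ means that $\tau$ is obtained from $\sigma$ by a finite non-empty sequence of contracting half-Whitehead moves) is a strict partial order.
   Context: A chord diagram of degree $d$ is an oriented circle with $2d$ distinct points partitioned into $d$ pairs, the two points of each pair being joined by a chord (diagonal) drawn in the disc. A forest-chord diagram is a chord diagram in which intersecting chords never form a $k$-gon in the disc, but only vertices of valency $2k$ (i.e. $k$ chords passing through one common point). A signature of degree $d$ is a forest embedded in the closed unit disc $\mathbb{D}$, considered up to isotopy fixing the boundary circle, whose terminal vertices are the $4d$ points labelled $0,1,\dots,4d-1$ (labels read modulo $4d$), placed counterclockwise at the $4d$-th roots of unity. It is obtained by superimposing two forest-chord diagrams of degree $d$: a blue one on the even labels and a red one on the odd labels, such that red and blue chords intersect in exactly $d$ points, with each blue chord meeting only one red chord. When several chords of one colour pass through a common point, this last requirement is imposed on the chord systems obtained by smoothing all such points into pairwise disjoint chords. The vertices of a signature are: the $4d$ terminal vertices; $d$ inner vertices of valency $4$ where a red and a blue chord cross; and possibly inner vertices $\bar{\bar v}$ where $m\ge 2$ chords of the same colour meet. A contracting half-Whitehead move on a signature glues $m\ge 2$ chords of the same colour in one point $\bar{\bar v}$, in such a way that the obtained diagram is again a signature. The real codimension of a signature is the sum over its vertices $\bar{\bar v}$ of $2m(\bar{\bar v})-3$, where $m(\bar{\bar v})$ is the number of chords meeting at $\bar{\bar v}$. *)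

(* Defs.v *)
From mathcomp Require Import all_boot.
From Stdlib Require Export Relation_Operators RelationClasses.

Set Implicit Arguments.
Unset Strict Implicit.
Unset Printing Implicit Defensive.

(* The points 0, ..., n-1 lie counterclockwise on the circle. A chord is the
   set of its two endpoints, a vertex is the set of the chords through it. *)
Notation chord n := {set 'I_n}.
Notation vertex n := {set chord n}.

Definition chord_diagram n (X : {set 'I_n}) (C : {set chord n}) : bool :=
  partition C X && [forall c in C, #|c| == 2].

(* The endpoints of c' lie on different sides of c. *)
Definition cross n (c c' : chord n) : bool :=
  [exists a in c, exists b in c, exists x in c', exists y in c',
    [&& a < x, x < b & (b < y) || (y < a)]].

(* The k sides c i are distinct chords, the k corners v i are distinct
   vertices, and the corner v i joins the side c i to the next one; ordS is
   the cyclic successor. Chords concurrent in one vertex form no polygon. *)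
Definition polygon n (V : {set vertex n}) (k : nat)
    (c : 'I_k -> chord n) (v : 'I_k -> vertex n) : Prop :=
  [/\ 2 <= k, injective c, injective v, (forall i, v i \in V)
    & forall i, (c i \in v i) /\ (c (ordS i) \in v i)].

Definition no_polygon n (V : {set vertex n}) : Prop :=
  forall k (c : 'I_k -> chord n) (v : 'I_k -> vertex n), ~ polygon V c v.

Record drawing n := Drawing {
  chords : {set chord n};
  vertices : {set vertex n} }.

(* A drawing of chords in the disc up to isotopy fixing the circle. As there
   is no 2-gon, two chords meet at most once, and they meet if and only if
   their endpoints are interleaved. At an inner vertex of valency 2k the k
   chords are the pairs of opposite branches. *)
Definition forest_chord_diagram n (X : {set 'I_n}) (D : drawing n) : Prop :=
  [/\ chord_diagram X (chords D),
      (forall v, v \in vertices D -> (v \subset chords D) /\ 2 <= #|v|),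
      (forall c c', c \in chords D -> c' \in chords D -> c != c' ->
        cross c c' = [exists v in vertices D, (c \in v) && (c' \in v)])
    & no_polygon (vertices D)].

(* The chords K are replaced by chords K' with the same endpoints. A vertex w
   not inside K lies on at most one chord of K; it becomes w', with that chord
   exchanged for the chord of K' that now runs through the same place. *)
Definition rerouted n (K K' : {set chord n}) (w w' : vertex n) : Prop :=
  w' :\: K' = w :\: K /\
  ((w :&: K = set0 /\ w' :&: K' = set0) \/
   exists c c', [/\ w :&: K = [set c], w' :&: K' = [set c'] & c :&: c' != set0]).

(* D' is obtained from D by reconnecting the endpoints of the chords K within
   K, the rest of the drawing being unchanged: the vertices of D' not inside
   K' are those of D not inside K. *)
Definition reconnect n (X : {set 'I_n}) (K K' : {set chord n})
    (D D' : drawing n) : Prop :=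
  [/\ K \subset chords D,
      chord_diagram (cover K) K',
      chords D' = (chords D :\: K) :|: K',
      forest_chord_diagram X D'
    & exists f : vertex n -> vertex n,
      [/\ {in [set w in vertices D | ~~ (w \subset K)] &, injective f},
          [set w in vertices D' | ~~ (w \subset K')] =
            f @: [set w in vertices D | ~~ (w \subset K)]
        & forall w, w \in vertices D -> ~~ (w \subset K) ->
            rerouted K K' w (f w)]].

Definition smooth_vertex n (X : {set 'I_n}) (D D' : drawing n) : Prop :=
  exists (v M : {set chord n}), [/\ v \in vertices D,
    (forall c c', c \in M -> c' \in M -> ~~ cross c c')
    & reconnect X v M D D'].

(* D' is a system of pairwise disjoint chords obtained by smoothing all the
   vertices of D. *)
Definition smoothing n (X : {set 'I_n}) (D D' : drawing n) : Prop :=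
  clos_refl_trans _ (smooth_vertex X) D D' /\ vertices D' = set0.

(* Gluing the chords K in one point: their 2 #|K| ends become the branches of
   a single vertex, through which they run as the pairwise crossing chords K'.
   The chords K may already meet in some vertices, which are then merged, but
   they are not already all the chords through one vertex. *)
Definition glue n (X : {set 'I_n}) (D D' : drawing n) : Prop :=
  exists K K' : {set chord n}, [/\ 2 <= #|K|, K \notin vertices D, K' \in vertices D'
    & reconnect X K K' D D'].

Definition even_labels d : {set 'I_(4 * d)} := [set i : 'I_(4 * d) | ~~ odd i].
Definition odd_labels d : {set 'I_(4 * d)} := [set i : 'I_(4 * d) | odd i].

Definition bicolour_vertices n (B R : drawing n) : {set vertex n} :=
  [set [set b; r] | b in chords B, r in chords R & cross b r].

Definition is_signature d (B R : drawing (4 * d)) : Prop :=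
  [/\ forest_chord_diagram (even_labels d) B,
      forest_chord_diagram (odd_labels d) R,
      no_polygon (vertices B :|: vertices R :|: bicolour_vertices B R),
      #|bicolour_vertices B R| = d
    & forall B' R', smoothing (even_labels d) B B' ->
        smoothing (odd_labels d) R R' ->
        forall b, b \in chords B' -> #|[set r in chords R' | cross b r]| = 1].

Record signature d := Signature {
  blue : drawing (4 * d);
  red : drawing (4 * d);
  signatureP : is_signature blue red }.

Definition contracting_move d (s t : signature d) : Prop :=
  (glue (even_labels d) (blue s) (blue t) /\ red t = red s) \/
  (blue t = blue s /\ glue (odd_labels d) (red s) (red t)).

Definition incidence d : signature d -> signature d -> Prop :=
  clos_trans (signature d) (@contracting_move d).

(* Main.v *)
Require Import Defs.
From mathcomp Require Import all_boot.

Set Implicit Arguments.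
Unset Strict Implicit.
Unset Printing Implicit Defensive.

(** Transitivity is built into the transitive closure, so the point is that no
    sequence of contracting moves returns to its starting signature.  This
    follows from a monovariant: the number of pairs of chords of the same
    colour that meet, written as the sum of ['C(m, 2)] over the vertices where
    [m] chords meet.

    Let a move glue the chords [K], which become [K'].  The vertices that are
    not inside [K] keep their valencies.  After the move the only vertex inside
    [K'] is [K'] itself, since another one would form a digon with it; so the
    new vertices contribute ['C(#|K|, 2)], the greatest possible number.
    Before the move, the vertices inside [K] account for each pair of chords of
    [K] at most once (no digon), hence for at most ['C(#|K|, 2)] pairs, and
    for strictly fewer: if every two chords of [K] met at a vertex inside [K]
    while [K] was not a vertex, there would be a triangle.  This last step is
    [pairwise_meeting_concurrent], and the resulting strict growth is
    [glue_meeting_pairs].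

    The real codimension, the sum of [2 * m - 3], grows as well, but comparing
    codimensions requires excluding polygons of every length, whereas counting
    pairs comes down to digons and triangles. *)

Section Drawings.

Variable n : nat.
Implicit Types (V : {set vertex n}) (D : drawing n) (K : {set chord n}).

(** Listing the sides and corners, instead of indexing them by ordinals, reduces
    the incidences of a digon or a triangle to computation. *)
Lemma no_polygon_seq V (cs : seq (chord n)) (vs : seq (vertex n)) :
    no_polygon V -> 1 < size cs -> size vs = size cs -> uniq cs -> uniq vs ->
    {subset vs <= V} ->
  ~ forall i, i < size cs ->
      nth set0 cs i \in nth set0 vs i /\
      nth set0 cs (i.+1 %% size cs) \in nth set0 vs i.
Proof.
move=> noV cs_gt1 szvs Ucs Uvs sVs inc.
apply: (noV (size cs) (fun i => nth set0 cs i) (fun i => nth set0 vs i)).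
split=> //.
- by move=> i j /eqP; rewrite nth_uniq // => /eqP/val_inj.
- by move=> i j /eqP; rewrite nth_uniq ?szvs // => /eqP/val_inj.
- by move=> i; apply/sVs/mem_nth; rewrite szvs.
- by move=> i; apply: inc.
Qed.

Lemma no_digon V (v w : vertex n) (a b : chord n) :
    no_polygon V -> v \in V -> w \in V -> a != b ->
    a \in v -> b \in v -> a \in w -> b \in w -> v = w.
Proof.
move=> noV vV wV ab av bv aw bw; apply/eqP/negPn/negP => vw.
apply: (@no_polygon_seq V [:: a; b] [:: v; w]) => //=; try by rewrite inE andbT.
- by move=> x; rewrite !inE => /orP[] /eqP->.
- by move=> [|[|]].
Qed.

Lemma no_triangle V (u v w : vertex n) (a b c : chord n) :
    no_polygon V -> u \in V -> v \in V -> w \in V ->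
    uniq [:: a; b; c] -> uniq [:: u; v; w] ->
    a \in u -> b \in u -> b \in v -> c \in v -> c \in w -> a \in w -> False.
Proof.
move=> noV uV vV wV Uabc Uuvw au bu bv cv cw aw.
apply: (@no_polygon_seq V [:: a; b; c] [:: u; v; w]) => //.
- by move=> x; rewrite !inE => /or3P[] /eqP->.
- by move=> [|[|[|]]].
Qed.

(** A chord of [K] missing a vertex [v] would meet two chords of [v] at two
    further vertices, and so close a triangle. *)
Lemma pairwise_meeting_concurrent V K :
    no_polygon V -> 1 < #|K| ->
    (forall a b, a \in K -> b \in K -> a != b ->
       exists2 v, v \in V & [/\ v \subset K, a \in v & b \in v]) ->
  K \in V.
Proof.
move=> noV /card_gt1P[a [b [aK bK ab]]] meet.
have [u uV [uK au bu]] := meet a b aK bK ab.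
case: (boolP (K \subset u)) => [Ku|/subsetPn[c cK cu]].
  by rewrite (_ : K = u) //; apply/eqP; rewrite eqEsubset Ku.
have bc : b != c by apply: contraNneq cu => <-.
have ac : a != c by apply: contraNneq cu => <-.
have [v vV [_ bv cv]] := meet b c bK cK bc.
have [w wV [_ aw cw]] := meet a c aK cK ac.
exfalso; apply: (@no_triangle V u v w a b c) => //=.
  by rewrite !inE negb_or ab ac bc.
rewrite !inE negb_or andbT -andbA; apply/and3P; split.
- by apply: contraNneq cu => ->.
- by apply: contraNneq cu => ->.
- apply: contraNneq cu => vw; rewrite -vw in aw.
  by rewrite (no_digon noV uV vV ab).
Qed.

Definition pairs K : {set {set chord n}} :=
  [set e : {set chord n} | e \subset K & #|e| == 2].

Lemma card_pairs K : #|pairs K| = 'C(#|K|, 2).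
Proof. exact: cards_draws. Qed.

Definition meeting_pairs D : nat := \sum_(v in vertices D) 'C(#|v|, 2).

(** By the absence of digons each pair is counted at most once on the left; the
    inequality is strict because, by [pairwise_meeting_concurrent], some pair of
    [K] is not counted at all. *)
Lemma meeting_pairs_inside V K :
    no_polygon V -> {in V, forall v : vertex n, 1 < #|v|} ->
    1 < #|K| -> K \notin V ->
  \sum_(v in [set v in V | v \subset K]) 'C(#|v|, 2) < 'C(#|K|, 2).
Proof.
move=> noV V2 K2 KV; set W := [set v in V | v \subset K].
have [||trivW injW] := @trivIimset _ _ (mem W) pairs.
- move=> v w; rewrite !inE => /andP[vV _] /andP[wV _] wv.
  apply/pred0P => e; rewrite /= !inE; apply/negP.
  case/andP=> /andP[/subsetP ev /cards2P[a [b [ab e_ab]]]] /andP[/subsetP ew _].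
  have ae : a \in e by rewrite e_ab !inE eqxx.
  have be : b \in e by rewrite e_ab !inE eqxx orbT.
  case/eqP: wv.
  by apply: (no_digon noV wV vV ab (ew a ae) (ew b be) (ev a ae) (ev b be)).
- apply/imsetP => -[v]; rewrite inE => /andP[vV _] /esym/eqP.
  by rewrite -cards_eq0 card_pairs -leqn0 leqNgt bin_gt0 V2.
under eq_bigr do rewrite -card_pairs.
rewrite -(big_imset (fun A : {set {set chord n}} => #|A|) injW) /=.
rewrite (eqP trivW) -card_pairs; apply: proper_card; apply/properP; split.
  apply/bigcupsP => _ /imsetP[v + ->]; rewrite inE => /andP[_ vK].
  apply/subsetP => e; rewrite !inE => /andP[ev ->].
  by rewrite (subset_trans ev vK).
case: (boolP [exists e in pairs K, e \notin cover (pairs @: W)]) => [/exists_inP[]|].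
  by move=> e; exists e.
move/exists_inPn => all_covered; case/negP: KV.
apply: pairwise_meeting_concurrent => // a b aK bK ab.
have abK : [set a; b] \in pairs K.
  by rewrite inE cards2 ab subUset !sub1set aK bK.
have /negPn/bigcupP[_ /imsetP[v + ->]] := all_covered _ abK.
rewrite !inE subUset !sub1set => /andP[vV vK] /andP[/andP[av bv] _].
by exists v.
Qed.

Lemma card_cover_chords (X : {set 'I_n}) C K :
  chord_diagram X C -> K \subset C -> #|cover K| = #|K| * 2.
Proof.
case/andP=> /and3P[_ tC _] /forall_inP C2 KC.
have /eqP <- := trivIsetS KC tC.
rewrite (eq_bigr (fun=> 2)) ?sum_nat_const // => c cK.
by apply/eqP/C2/(subsetP KC).
Qed.

Lemma card_reconnect (X : {set 'I_n}) K K' D D' :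
  chord_diagram X (chords D) -> reconnect X K K' D D' -> #|K'| = #|K|.
Proof.
move=> cD [KD cK' _ _ _]; apply/eqP; rewrite -(eqn_pmul2r (isT : 0 < 2)).
rewrite -(card_cover_chords cK' (subxx _)) -(card_cover_chords cD KD).
by case/andP: cK' => /and3P[/eqP-> _ _] _.
Qed.

Lemma card_rerouted K K' (w w' : vertex n) : rerouted K K' w w' -> #|w'| = #|w|.
Proof.
case=> wD meetK; rewrite -(cardsID K' w') -(cardsID K w) wD; congr (_ + _).
by case: meetK => [[-> ->]|[c [c' [-> -> _]]]]; rewrite ?cards0 ?cards1.
Qed.

Lemma sum_reconnect_outside (X : {set 'I_n}) K K' D D' (F : nat -> nat) :
    reconnect X K K' D D' ->
  \sum_(w in [set w in vertices D' | ~~ (w \subset K')]) F #|w|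
    = \sum_(w in [set w in vertices D | ~~ (w \subset K)]) F #|w|.
Proof.
case=> _ _ _ _ [f [injf -> rr]]; rewrite big_imset //=.
apply: eq_bigr => w; rewrite inE => /andP[wD wK].
by rewrite (card_rerouted (rr w wD wK)).
Qed.

Lemma meeting_pairsID D K :
  meeting_pairs D = \sum_(v in [set v in vertices D | v \subset K]) 'C(#|v|, 2)
    + \sum_(v in [set v in vertices D | ~~ (v \subset K)]) 'C(#|v|, 2).
Proof.
rewrite /meeting_pairs (bigID (fun v : vertex n => v \subset K)) /=.
by congr (_ + _); apply: eq_bigl => v; rewrite inE.
Qed.

Lemma vertices_inside_vertex V K :
    no_polygon V -> {in V, forall v : vertex n, 1 < #|v|} -> K \in V ->
  [set v in V | v \subset K] = [set K].
Proof.
move=> noV V2 KV; apply/setP => v; rewrite !inE; apply/andP/eqP => [[vV vK]|->//].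
have /card_gt1P[a [b [av bv ab]]] := V2 v vV.
by apply: (no_digon noV vV KV ab av bv); apply: (subsetP vK).
Qed.

Lemma glue_meeting_pairs (X : {set 'I_n}) D D' :
    forest_chord_diagram X D -> glue X D D' ->
  meeting_pairs D < meeting_pairs D'.
Proof.
move=> [cD vD _ noD] [K [K' [K2 KD K'D' rec]]].
have [_ _ _ [_ vD' _ noD'] _] := rec.
rewrite (meeting_pairsID D K) (meeting_pairsID D' K').
rewrite (sum_reconnect_outside (fun m => 'C(m, 2)) rec) ltn_add2r.
rewrite (vertices_inside_vertex noD' _ K'D'); last by move=> v /vD'[].
rewrite big_set1 (card_reconnect cD rec).
by apply: meeting_pairs_inside => // v /vD[].
Qed.

End Drawings.

Definition signature_meeting_pairs d (s : signature d) : nat :=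
  meeting_pairs (blue s) + meeting_pairs (red s).

Lemma contracting_move_meeting_pairs d (s t : signature d) :
  contracting_move s t -> signature_meeting_pairs s < signature_meeting_pairs t.
Proof.
have [fB fR _ _ _] := signatureP s; rewrite /signature_meeting_pairs.
case=> [[gB ->]|[-> gR]]; first by rewrite ltn_add2r (glue_meeting_pairs fB).
by rewrite ltn_add2l (glue_meeting_pairs fR).
Qed.

Lemma incidence_meeting_pairs d (s t : signature d) :
  incidence s t -> signature_meeting_pairs s < signature_meeting_pairs t.
Proof.
elim=> [x y|x y z _ xy _]; first exact: contracting_move_meeting_pairs.
exact: ltn_trans.
Qed.

Theorem lemma9 (d : nat) (hd : 1 <= d) : StrictOrder (@incidence d).
Proof.
split=> [s /incidence_meeting_pairs|s t u]; first by rewrite ltnn.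
exact: t_trans.
Qed.
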